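(* Suppose that the variational inequality $$J(x^\dagger)-J(x)\le\Phi(\|Ax-Ax^\dagger\|)\quad\text{for all }x\in X$$ holds for some index function $\Phi$. Consider the related index function $\tilde\Phi(t):=\Phi(\sqrt t)$, $t>0$. Then the following assertions hold true. (1) The inequality $$\frac1\alpha\bigl(T_\alpha(x^\dagger;Ax^\dagger)-T_\alpha(x_\alpha;Ax^\dagger)\bigr)\le\Psi(\alpha)\quad\text{for all }\alpha>0$$ is valid with the function $$\Psi(\alpha)=\sup_{t>0}\Bigl[\Phi(t)-\frac{t^2}{2\alpha}\Bigr],\quad \alpha>0,$$ which is increasing for all $\alpha>0$ but may take the value $+\infty$. (2) If the function $\tilde\Phi$ is concave, then the function $\Psi$ of (1) has the representation $$\Psi(\alpha)=\frac{\tilde\Phi^{-*}(2\alpha)}{2\alpha},\quad\alpha>0,$$ where $\tilde\Phi^{-*}$ is the Fenchel conjugate of the convex index function $\tilde\Phi^{-1}$. (3) If, moreover (in addition to $\tilde\Phi$ being concave), the quotient function $s\mapsto s^2/\Phi(s)$ is an index function, and hence strictly increasing for all $0<s<\infty$, then $\Psi$ also constitutes an index function, and the error estimate $$B_{\xi_\alpha^\delta}(x_\alpha^\delta;x^\dagger)\le\frac{\delta^2}{2\alpha}+\Psi(\alpha)\quad\text{for all }\alpha>0$$ holds.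
   Context: Setting. $X$ is an infinite-dimensional Banach space, $H$ an infinite-dimensional Hilbert space with norm $\|\cdot\|$, and $A:X\to H$ a bounded linear operator with non-closed range; $A^*:H\to X^*$ is its adjoint. $J:X\to[0,\infty]$ is a proper convex functional, lower semi-continuous with respect to weak (or weak$^*$) sequential convergence, such that for every $c\ge0$ the sublevel set $\{x\in X: J(x)\le c\}$ is weakly (or weak$^*$) sequentially compact. $y\in \mathrm{range}(A)$, and $Ax=y$ has at least one solution with finite penalty value. $x^\dagger\in X$ denotes a $J$-minimizing solution: $Ax^\dagger=y$ and $J(x^\dagger)=\min\{J(x): x\in X, Ax=y\}<\infty$. The noisy data $y^\delta\in H$ satisfy $\|y^\delta-y\|\le\delta$, with $\delta\ge0$. Tikhonov functional: for $\alpha>0$ and $v\in H$, $T_\alpha(x;v):=\frac12\|Ax-v\|^2+\alpha J(x)$, $x\in X$. For each $\alpha>0$, $x_\alpha$ is an (arbitrarily selected) minimizer of $T_\alpha(\cdot;y)$ over $X$ and $x_\alpha^\delta$ is an (arbitrarily selected) minimizer of $T_\alpha(\cdot;y^\delta)$ over $X$. Bregman distance: for $z\in X$ and $\zeta\in\partial J(z)\subset X^*$ (convex subdifferential), $B_\zeta(z;x):=J(x)-J(z)-\langle\zeta,x-z\rangle$, $x\in X$. Convention: $\xi_\alpha^\delta\in\partial J(x_\alpha^\delta)$ is a subgradient satisfying the optimality condition $A^*(Ax_\alpha^\delta-y^\delta)+\alpha\,\xi_\alpha^\delta=0$. An index function is a function $\varphi:(0,\infty)\to(0,\infty)$ that is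 continuous, strictly increasing and satisfies $\lim_{t\to+0}\varphi(t)=0$; it is extended by $\varphi(0):=0$. Fenchel conjugate: for a convex (index) function $f$, $f^*(t):=\sup_{s\ge0}(st-f(s))$, $t>0$. Here $\tilde\Phi^{-1}$ is the inverse function of $\tilde\Phi$, with $\tilde\Phi^{-1}(0)=0$, and with value $+\infty$ outside the range of $\tilde\Phi$ in case $\tilde\Phi$ is bounded.
   Formalization: In (3), Ψ may be +∞ (e.g. Φ(s)=s+s²), so it is shown to be an index function allowing the value +∞ (continuous where finite), and a finite-valued one if s²/Φ(s)→∞ as s→∞, exactly when Ψ is finite; convexity of Φ̃⁻¹ is not asserted. *)

(* Defs.v *)
From HB Require Import structures.
From mathcomp Require Import all_boot all_order all_algebra.
From mathcomp Require Import all_classical all_reals all_analysis.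

Set Implicit Arguments.
Unset Strict Implicit.
Unset Printing Implicit Defensive.

Import Order.TTheory GRing.Theory Num.Theory.
Import numFieldNormedType.Exports.

Local Open Scope classical_set_scope.
Local Open Scope ring_scope.
Local Open Scope ereal_scope.

Section Spaces.
Context {R : realType}.

Definition infinite_dimensional (V : lmodType R) : Prop :=
  ~ exists (n : nat) (e : 'I_n -> V),
      forall x : V, exists c : 'I_n -> R, x = (\sum_(i < n) c i *: e i)%R.

Definition continuous_dual (X : normedModType R) : set (X -> R) :=
  [set f : X -> R | scalar f /\ continuous f].

Definition weak_cvg (X : normedModType R) (u : nat -> X) (x : X) : Prop :=
  forall f, continuous_dual f -> f (u n) @[n --> \oo] --> f x.

(* [p] exhibits [X] as the dual space of [Z]: [x |-> p x] is a linear isometry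
   of [X] onto [continuous_dual Z], the latter carrying the operator norm. *)
Definition predual_pairing (X Z : normedModType R) (p : X -> Z -> R) : Prop :=
  [/\ forall x, continuous_dual (p x),
      forall z, scalar (p ^~ z),
      forall f, continuous_dual f -> exists x, p x = f &
      forall x, (`|x|)%:E = ereal_sup [set `|p x z|%:E | z in [set z : Z | (`|z| <= 1)%R]]].

Definition weak_star_cvg (X Z : normedModType R) (p : X -> Z -> R)
    (u : nat -> X) (x : X) : Prop :=
  forall z, p (u n) z @[n --> \oo] --> p x z.

(* The two admissible notions of sequential convergence; the second one is
   available only when [X] is a dual space. *)
Definition weak_or_weak_star (X : normedModType R)
    (scvg : (nat -> X) -> X -> Prop) : Prop :=
  scvg = @weak_cvg X \/
  exists (Z : normedModType R) (p : X -> Z -> R),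
    predual_pairing p /\ scvg = weak_star_cvg p.

Definition seq_lsc (X : Type) (scvg : (nat -> X) -> X -> Prop)
    (J : X -> \bar R) : Prop :=
  forall u x, scvg u x -> J x <= limn_einf (J \o u).

Definition seq_compact (X : Type) (scvg : (nat -> X) -> X -> Prop)
    (K : set X) : Prop :=
  forall u : nat -> X, (forall n, K (u n)) ->
    exists (k : nat -> nat) (x : X),
      [/\ increasing_seq k, K x & scvg (u \o k) x].

End Spaces.

Section Functionals.
Context {R : realType}.

Definition proper_functional (X : Type) (J : X -> \bar R) : Prop :=
  (forall x, J x != -oo) /\ exists x, J x < +oo.

Definition convex_functional (X : lmodType R) (J : X -> \bar R) : Prop :=
  forall (x y : X) (t : R), (0 <= t <= 1)%R ->
    J (t *: x + (1 - t) *: y)%R <= t%:E * J x + (1 - t)%:E * J y.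

Definition subdifferential (X : normedModType R) (J : X -> \bar R) (z : X) :
    set (X -> R) :=
  [set zeta : X -> R | continuous_dual zeta /\ forall x, J z + (zeta (x - z)%R)%:E <= J x].

Definition bregman (X : normedModType R) (J : X -> \bar R) (zeta : X -> R)
    (z x : X) : \bar R :=
  J x - J z - (zeta (x - z)%R)%:E.

Definition minimizer (X : Type) (F : X -> \bar R) (x : X) : Prop :=
  forall x', F x <= F x'.

Definition J_minimizing_solution (X H : Type) (A : X -> H) (J : X -> \bar R)
    (y : H) (x : X) : Prop :=
  [/\ A x = y, J x < +oo & forall x', A x' = y -> J x <= J x'].

Definition tikhonov (X H : normedModType R) (A : X -> H) (J : X -> \bar R)
    (alpha : R) (v : H) (x : X) : \bar R :=
  (2^-1 * `|A x - v| ^+ 2)%:E + alpha%:E * J x.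

Definition adjoint (X H : normedModType R) (dot : H -> H -> R) (A : X -> H)
    (h : H) : X -> R :=
  fun x => dot h (A x).

End Functionals.

Section IndexFunctions.
Context {R : realType}.

Definition index_function (phi : R -> R) : Prop :=
  [/\ phi 0%R = 0%R,
      forall t : R, (0 < t -> 0 < phi t)%R,
      {in `]0%R, +oo[, continuous phi},
      forall s t : R, (0 < s -> s < t -> phi s < phi t)%R &
      phi t @[t --> 0^'+] --> 0%R].

(* An index function that is allowed to take the value +oo: the requirements
   on [index_function] are kept, with continuity asked where [psi] is finite.
   The value +oo does occur for [Psi] below: with [Phi s = s + s ^+ 2], the
   function [t |-> Phi (sqrt t)] is concave and [s ^+ 2 / Phi s = s / (1 + s)]
   is an index function, but [Psi Phi alpha = +oo] for [alpha >= 1/2]. *)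
Definition ext_index_function (psi : R -> \bar R) : Prop :=
  [/\ forall t : R, (0 < t)%R -> 0 < psi t,
      {within [set t | (0 < t)%R /\ psi t < +oo], continuous psi},
      forall s t : R, (0 < s)%R -> (s < t)%R ->
        psi s < psi t \/ (psi s = +oo /\ psi t = +oo) &
      psi t @[t --> 0^'+] --> 0].

Definition concave_function (D : set R) (f : R -> R) : Prop :=
  @convex_function R R^o D (fun t => - f t)%R.

Definition Psi (Phi : R -> R) (alpha : R) : \bar R :=
  ereal_sup [set (Phi t - t ^+ 2 / (2 * alpha))%:E | t in [set t | (0 < t)%R]].

(* Inverse of an index function, with value +oo outside its range. *)
Definition ext_inverse (phi : R -> R) (s : R) : \bar R :=
  if s \in phi @` `[0%R, +oo[ then
    ('pinv_(fun=> 0%R) `[0%R, +oo[ phi s)%:E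
  else +oo.

Definition fenchel_conjugate (f : R -> \bar R) (t : R) : \bar R :=
  ereal_sup [set (s * t)%:E - f s | s in [set s | (0 <= s)%R]].

End IndexFunctions.

(* Main.v *)
(** Write the members of the family defining [Psi] as [Phi t - t^2 / 2 * b] with
    [b = 1 / alpha].  As a supremum of affine decreasing functions of [b], [Psi]
    is nonincreasing, convex and lower semicontinuous in [b], hence continuous
    where it is finite.  Near-maximizers stay away from [0] because [Psi] is
    positive, so changing [b] changes the supremum by a definite amount: this is
    strict monotonicity.  For [t >= s] with [s^2 / Phi s >= 2 alpha] the member
    is nonpositive, whence [Psi alpha <= Phi s]; this gives both the limit [0] at
    [0+] and finiteness when [s^2 / Phi s] is unbounded.  The error estimate is
    the optimality condition tested at [xdag - xa] together with Young's
    inequality for the inner product.  The Fenchel representation is the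
    substitution [s = Phi t], under which the inverse of [Phi (sqrt _)] takes the
    value [t^2]. *)

Require Import Defs.
From HB Require Import structures.
From mathcomp Require Import all_boot all_order all_algebra.
From mathcomp Require Import all_classical all_reals all_analysis.
From mathcomp Require Import ring lra.

Import Order.TTheory GRing.Theory Num.Theory.
Import numFieldNormedType.Exports.

Local Open Scope classical_set_scope.
Local Open Scope ring_scope.
Local Open Scope ereal_scope.

(** * Elementary bounds on [Psi] *)

Section PsiTheory.
Context {R : realType}.
Implicit Types (Phi : R -> R) (a b c t e : R).

Lemma index_function_mono Phi : index_function Phi ->
  {in `[0%R, +oo[ &, {mono Phi : s t / (s <= t)%R}}.
Proof.
move=> [P0 Ppos _ Plt _]; apply: le_mono_in => s t.
rewrite !in_itv /= !andbT.
rewrite le_eqVlt => /predU1P[<-|s0] _ st; last exact: Plt.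
by rewrite P0 Ppos.
Qed.

Lemma index_function_small Phi e : index_function Phi -> (0 < e)%R ->
  exists2 t, (0 < t)%R & (Phi t <= e)%R.
Proof.
move=> [_ _ _ _ /cvgrPdist_le /(_ _) P] e0.
near (0%R : R)^'+ => t; exists t; first by near: t; exact: nbhs_right_gt.
apply: (le_trans (ler_norm _)); rewrite -normrN -[X in `|X|%R]add0r.
by near: t; exact: P.
Unshelve. all: end_near. Qed.

Lemma Psi_le_mono Phi a b : (0 < a)%R -> (a <= b)%R -> Psi Phi a <= Psi Phi b.
Proof.
move=> a0 ab; apply: ge_ereal_sup => _ [t t0 <-].
apply: le_ereal_sup_tmp; exists (Phi t - t ^+ 2 / (2 * b))%:E; first by exists t.
rewrite lee_fin lerB// ler_wpM2l ?sqr_ge0// lef_pV2 ?posrE; lra.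
Qed.

(* The index set of [Psi] excludes [t = 0]; that case follows from [t -> 0+]. *)
Lemma Psi_ub Phi a t : index_function Phi -> (0 < a)%R -> (0 <= t)%R ->
  (Phi t - t ^+ 2 / (2 * a))%:E <= Psi Phi a.
Proof.
move=> [P0 Ppos _ _ _] a0; rewrite le_eqVlt => /predU1P[<-|t0]; last first.
  by apply: ereal_sup_ubound; exists t.
rewrite P0 expr0n mul0r subr0.
(* This [s] makes the penalty [s ^+ 2 / (2 * a)] equal to [e]. *)
apply/lee_addgt0Pr => e e0; pose s := Num.sqrt (e * (2 * a)).
have s0 : (0 < s)%R by rewrite sqrtr_gt0; nra.
have : (Phi s - s ^+ 2 / (2 * a))%:E <= Psi Phi a.
  by apply: ereal_sup_ubound; exists s.
rewrite sqr_sqrtr; last by nra.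
rewrite mulfK ?mulf_neq0 ?gt_eqF// EFinB leeBlDr// => /(le_trans _); apply.
by rewrite lee_fin ltW// Ppos.
Qed.

Lemma Psi_ge0 Phi a : index_function Phi -> (0 < a)%R -> 0 <= Psi Phi a.
Proof.
move=> HP a0; have := Psi_ub _ _ 0%R HP a0 (lexx _).
by case: HP => -> _ _ _ _; rewrite expr0n mul0r subr0.
Qed.

Lemma Psi_fin_num Phi a : index_function Phi -> (0 < a)%R ->
  (Psi Phi a \is a fin_num) = (Psi Phi a < +oo).
Proof. by move=> HP a0; rewrite ge0_fin_numE// Psi_ge0. Qed.

(** Where the quotient is at most [a], the member at [t] is at least [Phi t / 2]. *)
Lemma Psi_gt0 Phi a : index_function Phi ->
  index_function (fun s => s ^+ 2 / Phi s)%R -> (0 < a)%R -> 0 < Psi Phi a.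
Proof.
move=> HP HQ a0; have [t t0 Qt] := index_function_small _ a HQ a0.
apply: lt_le_trans (Psi_ub _ _ _ HP a0 (ltW t0)).
have Pt : (0 < Phi t)%R by case: HP => _ /(_ _ t0).
move: Qt; rewrite ler_pdivrMr// => Qt; rewrite lte_fin subr_gt0 ltr_pdivrMr; nra.
Qed.

(** The bound on the quotient is asked on a whole half-line, so that either monotonicity or
    divergence of the quotient can supply it. *)
Lemma Psi_le_quot Phi a s : index_function Phi -> (0 < a)%R -> (0 < s)%R ->
  (forall t, (s <= t)%R -> (2 * a <= t ^+ 2 / Phi t)%R) ->
  Psi Phi a <= (Phi s)%:E.
Proof.
move=> HP a0 s0 Q; apply: ge_ereal_sup => _ [t /= t0 <-]; rewrite lee_fin.
have Ppos r : (0 < r)%R -> (0 < Phi r)%R by case: HP => _ + _ _ _; apply.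
have Ps := Ppos _ s0; have Pt := Ppos _ t0.
have [/Q|ts] := leP s t.
  rewrite ler_pdivlMr// => Qt; suff : (Phi t <= t ^+ 2 / (2 * a))%R by lra.
  by rewrite ler_pdivlMr; nra.
have : (Phi t <= Phi s)%R by rewrite index_function_mono// ?in_itv/= ?andbT; lra.
have : (0 <= t ^+ 2 / (2 * a))%R by rewrite divr_ge0 ?sqr_ge0//; lra.
lra.
Qed.

(** * Limit at zero, continuity and strict growth of [Psi] *)

Lemma Psi_cvg0 Phi : index_function Phi ->
  index_function (fun s => s ^+ 2 / Phi s)%R ->
  Psi Phi t @[t --> (0%R : R)^'+] --> 0.
Proof.
move=> HP HQ.
have H e : (0 < e)%R -> \forall t \near (0%R : R)^'+, 0 <= Psi Phi t <= e%:E.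
  move=> e0; have [s s0 Ps] := index_function_small _ e HP e0.
  (* For [t] below this threshold, [2 * t] is at most the quotient at [s], hence at every
     [r >= s]. *)
  have Qs : (0 < s ^+ 2 / Phi s / 2)%R.
    by case: HQ => _ /(_ _ s0) + _ _ _ => Qs; rewrite divr_gt0.
  near=> t.
  have t0 : (0 < t)%R by near: t; exact: nbhs_right_gt.
  rewrite Psi_ge0//=; apply: (le_trans (Psi_le_quot _ _ s HP t0 s0 _)).
    move=> r sr; apply: (@le_trans _ _ (s ^+ 2 / Phi s)%R).
      by rewrite -ler_pdivlMl// mulrC; near: t; exact: nbhs_right_le.
    by rewrite (index_function_mono _ HQ)// in_itv/= andbT; lra.
  by rewrite lee_fin.
apply/fine_cvgP; split.
  apply: filterS (H _ ltr01) => t /andP[P0 P1].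
  by rewrite ge0_fin_numE// (le_lt_trans P1) ?ltry.
apply/cvgrPdist_le => e e0; apply: filterS (H _ e0) => t /=.
case: (Psi Phi t) => [r| |] /andP[]; rewrite ?lee_fin ?leey_eq//= => r0 re.
by rewrite sub0r normrN ger0_norm.
Unshelve. all: end_near. Qed.

Lemma Psi_left Phi a e : (0 < a)%R -> Psi Phi a < +oo -> (0 < e)%R ->
  exists2 b, (0 < b < a)%R & Psi Phi a <= Psi Phi b + e%:E.
Proof.
move=> a0 Pfin e0.
have [Pa|] := boolP (Psi Phi a \is a fin_num); last first.
  rewrite fin_numE negb_and !negbK (lt_eqF Pfin) orbF => /eqP ->.
  by exists (a / 2)%R; [lra | rewrite leNye].
have [_ [t /= t0 <-] lt_t] : exists2 z : \bar R,
    [set (Phi t - t ^+ 2 / (2 * a))%:E | t in [set t | (0 < t)%R]] z &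
    Psi Phi a - e%:E < z.
  by apply/ereal_sup_gt; rewrite lteBlDr// -lteBlDl// subee// lte_fin.
move: lt_t; rewrite -[in X in X -> _](fineK Pa) -EFinB lte_fin => lt_t.
set p := fine (Psi Phi a) in lt_t *.
pose c := (t ^+ 2 / 2)%R; have c0 : (0 < c)%R by rewrite divr_gt0 ?exprn_gt0.
(* [d] is the margin of the near-maximizer [t] over [p - e]. Raising [1 / a] by [d / c] costs its
   member exactly [d], leaving [p - e]. *)
pose d := (Phi t - t ^+ 2 / (2 * a) - (p - e))%R.
have d0 : (0 < d)%R by rewrite subr_gt0.
have i0 : (0 < a^-1 + d / c)%R by apply: addr_gt0; rewrite ?invr_gt0// divr_gt0.
exists (a^-1 + d / c)^-1%R.
  rewrite invr_gt0 i0/= -[X in (_ < X)%R]invrK ltf_pV2 ?posrE ?invr_gt0//.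
  by rewrite ltrDl divr_gt0.
rewrite -(fineK Pa) -/p -leeBlDr// -EFinB.
apply: ereal_sup_ubound; exists t => //; congr EFin.
suff -> : (t ^+ 2 / (2 * (a^-1 + d / c)^-1) = t ^+ 2 / (2 * a) + d)%R.
  by rewrite /d; ring.
by rewrite invfM invrK /c; field; rewrite !gt_eqF.
Qed.

(* Convexity in the variable [1 / a], between [1 / c] and [1 / a]. *)
Lemma Psi_right Phi a c e : index_function Phi -> (0 < a < c)%R ->
  Psi Phi c < +oo -> (0 < e)%R ->
  exists2 b, (a < b)%R & Psi Phi b <= Psi Phi a + e%:E.
Proof.
move=> HP /andP[a0 ac] cfin e0; have c0 := lt_trans a0 ac.
have lePP := Psi_le_mono Phi _ _ a0 (ltW ac).
have Pc : Psi Phi c \is a fin_num by rewrite Psi_fin_num.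
have Pa : Psi Phi a \is a fin_num.
  by rewrite Psi_fin_num// (le_lt_trans lePP).
move: lePP; rewrite -(fineK Pc) -(fineK Pa) lee_fin.
set p := fine (Psi Phi a); set q := fine (Psi Phi c) => pq.
(* The weight gives [l * (q - p) <= e]; the summand [e] in the denominator covers [p = q]. *)
pose l := (e / (e + (q - p)))%R.
have l0 : (0 < l)%R by rewrite divr_gt0//; lra.
have l1 : (l <= 1)%R by rewrite ler_pdivrMr; lra.
have le : (l * (q - p) <= e)%R.
  by rewrite mulrAC ler_pdivrMr; [nra|lra].
have ica : (c^-1 < a^-1)%R by rewrite ltf_pV2.
have ic0 : (0 < c^-1)%R by rewrite invr_gt0.
have ib0 : (0 < l * c^-1 + (1 - l) * a^-1)%R by nra.
exists (l * c^-1 + (1 - l) * a^-1)^-1%R.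
  by rewrite -[X in (X < _)%R]invrK ltf_pV2 ?posrE ?invr_gt0//; nra.
apply: ge_ereal_sup => _ [t t0 <-]; rewrite lee_fin.
have Hc : (Phi t - t ^+ 2 / (2 * c) <= q)%R.
  by rewrite -lee_fin /q fineK// Psi_ub// ltW.
have Ha : (Phi t - t ^+ 2 / (2 * a) <= p)%R.
  by rewrite -lee_fin /p fineK// Psi_ub// ltW.
(* The penalty is linear in [1 / b], so the member is at most [l * q + (1 - l) * p], that is
   [p + l * (q - p)]. *)
have -> : (t ^+ 2 / (2 * (l * c^-1 + (1 - l) * a^-1)^-1) =
    l * (t ^+ 2 / (2 * c)) + (1 - l) * (t ^+ 2 / (2 * a)))%R.
  by rewrite !invfM invrK; ring.
nra.
Qed.

Lemma Psi_cvg Phi a : index_function Phi -> (0 < a)%R -> Psi Phi a < +oo ->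
  Psi Phi x @[x --> within [set t | (0 < t)%R /\ Psi Phi t < +oo] (nbhs a)]
    --> Psi Phi a.
Proof.
move=> HP a0 afin; have Pa : Psi Phi a \is a fin_num by rewrite Psi_fin_num.
rewrite -(fineK Pa); apply/fine_cvgP; split.
  by rewrite near_withinE; near=> x => -[x0 xfin]; rewrite Psi_fin_num.
apply/cvgrPdist_le => e e0; rewrite near_withinE.
have [b /andP[b0 ba] Pb] := Psi_left _ _ e a0 afin e0.
have upper : \forall x \near a, (0 < x)%R /\ Psi Phi x < +oo ->
    Psi Phi x <= Psi Phi a + e%:E.
  (* If no larger [c] has a finite value, [a] is the right end of the finiteness domain and
     monotonicity suffices. *)
  have [[c /andP[ac cfin]]|Nc] := pselect (exists c, (a < c)%R && (Psi Phi c < +oo)).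
    have [|d ad Pd] := Psi_right _ a c _ HP _ cfin e0; first by rewrite a0.
    near=> x => -[x0 _]; apply: le_trans Pd; apply: Psi_le_mono => //.
    by near: x; exact: lt_le_nbhsl.
  near=> x => -[x0 xfin]; have [xa|ax] := leP x a.
    by rewrite (le_trans (Psi_le_mono Phi _ _ x0 xa))// leeDl// lee_fin ltW.
  by exfalso; apply: Nc; exists x; rewrite ax.
near=> x => -[x0 xfin].
have Px : Psi Phi x \is a fin_num by rewrite Psi_fin_num.
have : Psi Phi x <= Psi Phi a + e%:E.
  by move: (conj x0 xfin); near: x; exact: upper.
have : Psi Phi a <= Psi Phi x + e%:E.
  apply: (le_trans Pb); rewrite leeD2r// Psi_le_mono// ltW//.
  by near: x; exact: lt_nbhsr.
rewrite -(fineK Px) -(fineK Pa) !lee_fin /= => H1 H2.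
by rewrite ler_norml; lra.
Unshelve. all: end_near. Qed.

Lemma Psi_lt Phi a b : index_function Phi ->
  index_function (fun s => s ^+ 2 / Phi s)%R -> (0 < a)%R -> (a < b)%R ->
  Psi Phi a < +oo -> Psi Phi a < Psi Phi b.
Proof.
move=> HP HQ a0 ab afin; have Pa0 := Psi_gt0 _ _ HP HQ a0.
have Pa : Psi Phi a \is a fin_num by rewrite Psi_fin_num.
move: Pa0; rewrite -(fineK Pa) lte_fin; set p := fine _ => p0.
(* A member within [p / 2] of the supremum has [Phi t > p / 2 >= Phi s], which forces [t > s]. *)
have [s s0 Ps] := index_function_small _ _ HP (divr_gt0 p0 (ltr0n _ 2)).
have iab : (0 < (2 * a)^-1 - (2 * b)^-1)%R.
  by rewrite subr_gt0 ltf_pV2 ?posrE; lra.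
(* A lower bound, uniform in [t > s], for the gain of a member when [a] is replaced by [b]; the
   tolerance [Num.min d (p / 2)] is thereby recovered. *)
pose d := (s ^+ 2 * ((2 * a)^-1 - (2 * b)^-1))%R.
have d0 : (0 < d)%R by rewrite mulr_gt0// exprn_gt0.
have m0 : (0 < Num.min d (p / 2))%R by rewrite lt_min d0 divr_gt0.
have [_ [t /= t0 <-]] : exists2 z : \bar R,
    [set (Phi t - t ^+ 2 / (2 * a))%:E | t in [set t | (0 < t)%R]] z &
    (p - Num.min d (p / 2))%:E < z.
  by apply/ereal_sup_gt; rewrite -/(Psi Phi a) -(fineK Pa) lte_fin -/p; lra.
rewrite lte_fin => lt_t.
apply: lt_le_trans (Psi_ub _ b t HP _ (ltW t0)); last by lra.
rewrite lte_fin.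
have [md mp] : (Num.min d (p / 2) <= d /\ Num.min d (p / 2) <= p / 2)%R.
  by rewrite !ge_min !lexx orbT.
have : (0 < t ^+ 2 / (2 * a))%R by rewrite divr_gt0 ?exprn_gt0//; lra.
move=> q0; have st : (s < t)%R.
  rewrite ltNge; apply/negP => ts.
  have : (Phi t <= Phi s)%R by rewrite index_function_mono// ?in_itv/= ?andbT; lra.
  lra.
have : (d <= t ^+ 2 * ((2 * a)^-1 - (2 * b)^-1))%R.
  by rewrite ler_wpM2r ?ltW// ltr_pXn2r ?nnegrE ?ltW.
lra.
Qed.

(** * Fenchel representation *)

Lemma ext_inverseK Phi t : index_function Phi -> (0 <= t)%R ->
  ext_inverse (fun r => Phi (Num.sqrt r)) (Phi (Num.sqrt t)) = t%:E.
Proof.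
move=> HP t0; have tI : t \in `[0%R, +oo[%classic by rewrite inE/= in_itv/= t0.
rewrite /ext_inverse ifT; last by rewrite inE; exists t => //; exact: set_mem.
rewrite pinvKV// => r s.
rewrite !inE/= !in_itv/= !andbT => r0 s0 /eqP.
rewrite (inj_in_eq (inc_inj_in (index_function_mono _ HP))) ?in_itv/= ?sqrtr_ge0//.
by rewrite eqr_sqrt// => /eqP.
Qed.

Lemma Psi_conjugate Phi a : index_function Phi -> (0 < a)%R ->
  Psi Phi a =
  fenchel_conjugate (ext_inverse (fun t => Phi (Num.sqrt t))) (2 * a)
    * ((2 * a)^-1)%:E.
Proof.
move=> HP a0; have a20 : (0 < 2 * a)%R by lra.
apply/eqP; rewrite eq_le; apply/andP; split.
  apply: ge_ereal_sup => _ [t /= t0 <-]; rewrite lee_pdivlMr//.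
  apply: ereal_sup_ubound; exists (Phi t).
    by case: HP => _ /(_ _ t0) /ltW.
  have {2}-> : t = Num.sqrt (t ^+ 2) by rewrite sqrtr_sqr gtr0_norm.
  rewrite ext_inverseK ?sqr_ge0// -EFinB -EFinM.
  by rewrite mulrBl divfK// gt_eqF.
rewrite lee_pdivrMr//; apply: ge_ereal_sup => _ [s /= s0 <-].
(* Outside the range the inverse is [+oo], so the term of the conjugate is [-oo]. *)
have [[t t0 <-]|sN] := pselect (((fun r => Phi (Num.sqrt r)) @` `[0%R, +oo[) s);
  last first.
  rewrite /ext_inverse ifN ?addeNy ?leNye//.
  by apply: contra_notN sN => /set_mem.
move: t0; rewrite /= in_itv/= andbT => t0.
rewrite ext_inverseK// -lee_pdivrMr//.
(* The conjugate admits [s = 0], that is [t = 0], which [Psi_ub] includes. *)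
apply: le_trans (Psi_ub _ _ (Num.sqrt t) HP a0 (sqrtr_ge0 _)).
by rewrite -EFinB -EFinM lee_fin sqr_sqrtr// mulrBl mulfK// gt_eqF.
Qed.

End PsiTheory.

(** * Estimates for Tikhonov minimizers *)

Lemma tikhonov_minimizer_fin_num {R : realType} {X H : normedModType R}
    (A : X -> H) (J : X -> \bar R) (a : R) (v : H) (x z : X) :
  (forall x, 0 <= J x) -> J z < +oo -> (0 < a)%R ->
  minimizer (tikhonov A J a v) x -> J x \is a fin_num.
Proof.
move=> J0 Jz a0 /(_ z); rewrite /tikhonov.
have /fineK <- : J z \is a fin_num by rewrite ge0_fin_numE.
rewrite -EFinM -EFinD => H1; rewrite ge0_fin_numE//.
move: H1 (J0 x); case: (J x) => // [r _ _|]; first exact: ltry.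
by rewrite gt0_muley ?lte_fin// addey// leye_eq.
Qed.

Lemma tikhonov_gap_le {R : realType} {X H : normedModType R}
    (A : X -> H) (J : X -> \bar R) (Phi : R -> R) (xdag xa : X) (a : R) :
  (forall x, 0 <= J x) -> J xdag < +oo -> index_function Phi ->
  (forall x : X, J xdag - J x <= (Phi `|A x - A xdag|)%:E) -> (0 < a)%R ->
  minimizer (tikhonov A J a (A xdag)) xa ->
  (a^-1)%:E * (tikhonov A J a (A xdag) xdag - tikhonov A J a (A xdag) xa)
    <= Psi Phi a.
Proof.
move=> J0 Jdag HP vi a0 mina.
have Jd : J xdag \is a fin_num by rewrite ge0_fin_numE.
have Ja := tikhonov_minimizer_fin_num _ _ _ _ _ _ J0 Jdag a0 mina.
(* The member of [Psi] at the residual norm, possibly zero, already dominates the gap. *)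
apply: le_trans (Psi_ub _ _ _ HP a0 (normr_ge0 (A xa - A xdag)%R)).
move: (vi xa); rewrite /tikhonov -(fineK Jd) -(fineK Ja).
rewrite -!(EFinM, EFinB, EFinD) !lee_fin.
rewrite subrr normr0 expr0n mulr0 add0r.
set n := `|_|%R; set p := fine _; set q := fine _ => H1.
suff -> : (a^-1 * (a * p - (2^-1 * n ^+ 2 + a * q)) =
   (p - q) - n ^+ 2 / (2 * a))%R by rewrite lerB.
by field; rewrite gt_eqF.
Qed.

(** Young's inequality, by expanding the squared norm of [u - v]. *)
Lemma dot_le {R : realType} {H : normedModType R} (dot : {dot H for idfun})
    (u v : H) : (forall h : H, dot h h = (`|h| ^+ 2)%R) ->
  (2 * dot u v <= `|u| ^+ 2 + `|v| ^+ 2)%R.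
Proof.
move=> dotE; have := sqr_ge0 `|u - v|%R.
have := hnormB dot u v; rewrite /= expr0 mul1r !dotE => -> /=; lra.
Qed.

Lemma bregman_le {R : realType} {X H : normedModType R}
    (dot : {dot H for idfun}) (A : {linear X -> H}) (J : X -> \bar R)
    (Phi : R -> R) (xdag xa : X) (xi : X -> R) (v : H) (a delta : R) :
  (forall h : H, dot h h = (`|h| ^+ 2)%R) ->
  (forall x, 0 <= J x) -> J xdag < +oo -> index_function Phi ->
  (forall x : X, J xdag - J x <= (Phi `|A x - A xdag|)%:E) -> (0 < a)%R ->
  (`|v - A xdag| <= delta)%R ->
  minimizer (tikhonov A J a v) xa ->
  (forall x, adjoint dot A (A xa - v) x + a * xi x = 0)%R ->
  bregman J xi xa xdag <= (delta ^+ 2 / (2 * a))%:E + Psi Phi a.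
Proof.
move=> dotE J0 Jdag HP vi a0 vd mina opt.
have Jd : J xdag \is a fin_num by rewrite ge0_fin_numE.
have Ja := tikhonov_minimizer_fin_num _ _ _ _ _ _ J0 Jdag a0 mina.
apply: le_trans (leeD2l _ (Psi_ub _ _ _ HP a0 (normr_ge0 (A xa - A xdag)%R))).
move: (vi xa); rewrite /bregman -(fineK Jd) -(fineK Ja).
rewrite -!(EFinB, EFinD) !lee_fin => H1.
pose r := (A xa - A xdag)%R; pose e := (v - A xdag)%R.
(* The optimality condition at [xdag - xa] pairs [r - e] with [- r]. *)
have xiE : (xi (xdag - xa) = (`|r| ^+ 2 - dot e r) / a)%R.
  apply: (canRL (mulfK _)); first by rewrite gt_eqF.
  have := opt (xdag - xa)%R; rewrite /adjoint linearB.
  have -> : (A xa - v = r - e)%R by rewrite /r /e opprB addrA subrK.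
  have -> : (A xdag - A xa = - r)%R by rewrite /r opprB.
  by rewrite linearNr linearBl /= dotE; lra.
have := dot_le dot e r dotE.
have : (`|e| ^+ 2 <= delta ^+ 2)%R.
  by rewrite lerXn2r// nnegrE// (le_trans _ vd).
rewrite xiE -/r; move: H1; rewrite -/r; set n := `|r|%R; set d := dot e r.
set p := fine _; set q := fine _ => H1 H2 H3.
have -> : ((n ^+ 2 - d) / a = (2 * n ^+ 2 - 2 * d) / (2 * a))%R.
  by field; rewrite gt_eqF.
(* Over the denominator [2 * a] this is [2 * d <= delta ^+ 2 + n ^+ 2], Young's inequality with the
   noise bound. *)
suff : (delta ^+ 2 / (2 * a) - n ^+ 2 / (2 * a)
    + (2 * n ^+ 2 - 2 * d) / (2 * a) >= 0)%R by lra.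
by rewrite -mulrBl -mulrDl divr_ge0//; lra.
Qed.

(** * Index function property and conclusion *)

Lemma Psi_ext_index_function {R : realType} (Phi : R -> R) :
  index_function Phi -> index_function (fun s => s ^+ 2 / Phi s)%R ->
  ext_index_function (Psi Phi).
Proof.
move=> HP HQ; split.
- by move=> t; exact: Psi_gt0.
- by apply/subspace_continuousP => a [a0 afin]; exact: Psi_cvg.
- move=> s t s0 st; have [sfin|] := ltP (Psi Phi s) +oo.
    by left; exact: Psi_lt.
  rewrite leye_eq => /eqP soo; right; split=> //; apply/eqP.
  by rewrite -leye_eq -soo Psi_le_mono// ltW.
- exact: Psi_cvg0.
Qed.

Lemma Psi_index_function {R : realType} (Phi : R -> R) :
  index_function Phi -> index_function (fun s => s ^+ 2 / Phi s)%R ->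
  (s ^+ 2 / Phi s)%R @[s --> +oo%R] --> +oo%R ->
  exists psi : R -> R, index_function psi /\
    forall a : R, (0 < a)%R -> Psi Phi a = (psi a)%:E.
Proof.
move=> HP HQ Qoo.
have Pfin a : (0 < a)%R -> Psi Phi a \is a fin_num.
  move=> a0; have /cvgryPge /(_ (2 * a)%R) [M [_ QM]] := Qoo.
  (* Divergence bounds the quotient only strictly beyond [M], hence [M + 1]; the maximum with [1]
     ensures positivity. *)
  have s0 : (0 < Num.max 1 (M + 1))%R by rewrite lt_max ltr01.
  rewrite Psi_fin_num// (le_lt_trans (Psi_le_quot _ _ _ HP a0 s0 _)) ?ltry//.
  by move=> t; rewrite ge_max => /andP[_ Mt]; apply: QM; rewrite /=; lra.
have PE (a : R) : (0 < a)%R -> Psi Phi a = (fine (Psi Phi a))%:E.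
  by move=> a0; rewrite fineK// Pfin.
(* The value at [0] is set by hand: as [0] is its own inverse, the formula of [Psi] would give the
   supremum of [Phi] there. *)
exists (fun a => if (0 < a)%R then fine (Psi Phi a) else 0%R); split; last first.
  by move=> a a0; rewrite a0; exact: PE.
split; first by rewrite ltxx.
- by move=> t t0; rewrite t0 -lte_fin -PE// Psi_gt0.
- move=> a; rewrite in_itv/= andbT => a0.
  rewrite /continuous_at a0.
  have /fine_cvg : Psi Phi x @[x --> a] --> (fine (Psi Phi a))%:E.
    rewrite -PE//; have := Psi_cvg _ a HP a0.
    rewrite -Psi_fin_num// => /(_ (Pfin _ a0)).
    rewrite within_interior//.
    near=> x; have x0 : (0 < x)%R by near: x; exact: lt_nbhsr.
    by split=> //; rewrite -Psi_fin_num// Pfin.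
  apply: cvg_trans; apply: near_eq_cvg; near=> x.
  by rewrite ifT//; near: x; exact: lt_nbhsr.
- move=> s t s0 st; have t0 := lt_trans s0 st; rewrite s0 t0 -lte_fin -!PE//.
  by rewrite Psi_lt// -Psi_fin_num// Pfin.
- have /fine_cvg := Psi_cvg0 _ HP HQ.
  apply: cvg_trans; apply: near_eq_cvg; near=> x.
  by rewrite ifT//; near: x; exact: nbhs_right_gt.
Unshelve. all: end_near. Qed.

Theorem proposition4 (R : realType)
  (X : completeNormedModType R) (Xinf : infinite_dimensional X)
  (H : completeNormedModType R) (Hinf : infinite_dimensional H)
  (dot : {dot H for idfun}) (dot_norm : forall h : H, dot h h = (`|h| ^+ 2)%R)
  (A : {linear X -> H}) (A_bounded : bounded_near A (nbhs (0%R : X)))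
  (A_nonclosed : ~ closed (range A))
  (J : X -> \bar R) (J_ge0 : forall x, 0 <= J x)
  (J_proper : proper_functional J) (J_convex : convex_functional J)
  (scvg : (nat -> X) -> X -> Prop) (scvg_weak : weak_or_weak_star scvg)
  (J_lsc : seq_lsc scvg J)
  (J_compact : forall c : R, (0 <= c)%R ->
     seq_compact scvg [set x | J x <= c%:E])
  (y : H) (y_range : range A y)
  (y_finite : exists x : X, A x = y /\ J x < +oo)
  (xdag : X) (xdag_min : J_minimizing_solution A J y xdag)
  (delta : R) (delta_ge0 : (0 <= delta)%R)
  (ydelta : H) (ydelta_noise : (`|ydelta - y| <= delta)%R)
  (Phi : R -> R) (Phi_index : index_function Phi)
  (varineq : forall x : X, J xdag - J x <= (Phi `|A x - A xdag|)%:E) :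
  let Phit := (fun t : R => Phi (Num.sqrt t)) in
  let quot := (fun s : R => s ^+ 2 / Phi s)%R in
  [/\ (* (1) *)
      (forall (alpha : R) (xalpha : X), (0 < alpha)%R ->
         minimizer (tikhonov A J alpha y) xalpha ->
         (alpha^-1)%:E * (tikhonov A J alpha (A xdag) xdag
                          - tikhonov A J alpha (A xdag) xalpha)
         <= Psi Phi alpha)
      /\ (forall a b : R, (0 < a)%R -> (a <= b)%R -> Psi Phi a <= Psi Phi b),
      (* (2) *)
      concave_function `]0%R, +oo[ Phit ->
      forall alpha : R, (0 < alpha)%R ->
        Psi Phi alpha =
        fenchel_conjugate (ext_inverse Phit) (2 * alpha)%R * ((2 * alpha)^-1)%:E
    & (* (3) *)
      concave_function `]0%R, +oo[ Phit -> index_function quot ->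
      [/\ ext_index_function (Psi Phi),
          (quot s @[s --> +oo%R] --> +oo%R ->
           exists psi : R -> R, index_function psi /\
             forall alpha : R, (0 < alpha)%R -> Psi Phi alpha = (psi alpha)%:E)
        & forall (alpha : R) (xad : X) (xi : X -> R), (0 < alpha)%R ->
            minimizer (tikhonov A J alpha ydelta) xad ->
            subdifferential J xad xi ->
            (forall x : X,
               adjoint dot A (A xad - ydelta)%R x + alpha * xi x = 0)%R ->
            bregman J xi xad xdag
            <= (delta ^+ 2 / (2 * alpha))%:E + Psi Phi alpha]].
Proof.
case: xdag_min => Ay Jdag _ Phit quot; split.
- split; last exact: Psi_le_mono.
  by move=> a xa a0; rewrite -{1}Ay; exact: tikhonov_gap_le.
- by move=> _ a; exact: Psi_conjugate.
- move=> _ Hquot; split; first exact: Psi_ext_index_function.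
    exact: Psi_index_function.
  move=> a xa xi a0 mina _; apply: (bregman_le dot) mina => //; by rewrite Ay.
Qed.
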